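(* Let $U\in U(2^n)$ be an unknown unitary to which we have oracle access, and suppose some $C\in\mathcal{C}_n$ satisfies $D(U,C)\le\epsilon<\frac{\sqrt2}{4}$. Then, with success probability at least $1-\delta$, one can learn $C$ up to global phase using $$\mathcal{O}\!\left(\frac{n\log(n/\delta)}{(\frac{\sqrt2}{4}-\epsilon)^2}\right)$$ queries to $U$.
   Context: For $d\times d$ unitaries ($d=2^n$), $D(U_1,U_2)=\frac{1}{\sqrt{2d^2}}\|U_1\otimes U_1^*-U_2\otimes U_2^*\|_2$ with $\|\cdot\|_2$ the Frobenius norm; equivalently $D(U_1,U_2)=\sqrt{1-\frac{1}{d^2}|\mathrm{Tr}[U_1U_2^\dagger]|^2}$. The Pauli group $\mathcal{P}_n$ consists of $i^kP_1\otimes\cdots\otimes P_n$ with $P_j\in\{I,X,Y,Z\}$, and the Clifford group is $\mathcal{C}_n=\{W\in U(2^n): W\mathcal{P}_nW^\dagger\subseteq\mathcal{P}_n\}$. An oracle query is one application of $U$ to an $n$-qubit register within a quantum circuit. *)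

(* Defs.v *)
From HB Require Import structures.
From mathcomp Require Import all_boot all_order all_algebra.
From mathcomp Require Import complex mxtens.
From mathcomp Require Import boolp reals exp.
Set Implicit Arguments. Unset Strict Implicit. Unset Printing Implicit Defensive.
Import Order.TTheory GRing.Theory Num.Theory.
Local Open Scope ring_scope.

Section QuantumDefs.
Variable R : realType.
Local Notation C := (R[i]).

Definition abs2 (z : C) : R := complex.Re z ^+ 2 + complex.Im z ^+ 2.

Definition adj m n (A : 'M[C]_(m, n)) : 'M[C]_(n, m) := (map_mx (@conjc R) A)^T.

Definition unitary d (U : 'M[C]_d) : Prop := U *m adj U = 1%:M.

Definition dist d (U1 U2 : 'M[C]_d) : R :=
  Num.sqrt (1 - abs2 (\tr (U1 *m adj U2)) / (d%:R) ^+ 2).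

Definition sigma (a : 'I_4) : 'M[C]_2 :=
  match val a with
  | 0 => 1%:M
  | 1 => \matrix_(i, j) (if i == j then 0 else 1)
  | 2 => \matrix_(i, j) (if i == j then 0 else if val i == 0%N then - 'i%C else 'i%C)
  | _ => \matrix_(i, j) (if i == j then (if val i == 0%N then 1 else -1) else 0)
  end.

(* pauli_tens n s = P_{n-1} (x) ... (x) P_1 (x) P_0 with P_l = sigma (s l)
   (same recursion pattern as real_closed.mxtens.ntensmx, so that the
   dimension is 2 ^ n by conversion) *)
Fixpoint pauli_tens_rec (k : nat) (s : nat -> 'I_4) : 'M[C]_(2 ^ k.+1) :=
  match k return 'M[C]_(2 ^ k.+1) with
  | 0 => sigma (s 0%N)
  | k'.+1 => sigma (s k) *t pauli_tens_rec k' s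
  end.

Definition pauli_tens (n : nat) (s : nat -> 'I_4) : 'M[C]_(2 ^ n) :=
  match n return 'M[C]_(2 ^ n) with
  | 0 => 1%:M
  | k.+1 => pauli_tens_rec k s
  end.

Definition pauli_group n (P : 'M[C]_(2 ^ n)) : Prop :=
  exists (k : nat) (s : nat -> 'I_4), P = ('i%C ^+ k) *: pauli_tens n s.

Definition clifford n (W : 'M[C]_(2 ^ n)) : Prop :=
  unitary W /\ forall P, pauli_group P -> pauli_group (W *m P *m adj W).

(* A quantum query algorithm on the n-qubit oracle register plus [anc] ancilla
   qubits, making [nq] queries: it starts in |0...0>, applies
   V_0, O, V_1, O, ..., O, V_nq (O = U (x) I the oracle), then measures in the
   computational basis and outputs a classical guess [output k] for outcome k.
   (Intermediate measurements / classical randomness / adaptivity are absorbed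
   by the deferred measurement principle.) *)
Record query_alg (n : nat) := QueryAlg {
  anc : nat;
  nq : nat;
  gates : 'I_nq.+1 -> 'M[C]_(2 ^ n * 2 ^ anc);
  gates_unitary : forall t, unitary (gates t);
  output : 'I_(2 ^ n * 2 ^ anc) -> 'M[C]_(2 ^ n)
}.
Arguments gates {n} q t.
Arguments output {n} q k.
Arguments gates_unitary {n} q t.

Definition oracle n a (U : 'M[C]_(2 ^ n)) : 'M[C]_(2 ^ n * 2 ^ a) :=
  U *t (1%:M : 'M[C]_(2 ^ a)).

Definition final_state n (A : query_alg n) (U : 'M[C]_(2 ^ n))
  : 'cV[C]_(2 ^ n * 2 ^ anc A) :=
  let O := oracle (anc A) U in
  let init : 'cV[C]_(2 ^ n * 2 ^ anc A) :=
    \col_k (if val k == 0%N then 1 else 0) in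
  foldl (fun v (t : 'I_(nq A).+1) => gates A t *m (O *m v))
        (gates A ord0 *m init)
        (behead (enum 'I_(nq A).+1)).

Definition eq_up_to_phase d (A B : 'M[C]_d) : Prop :=
  exists z : C, `|z| = 1 /\ A = z *: B.

Definition success_prob n (A : query_alg n) (U C0 : 'M[C]_(2 ^ n)) : R :=
  \sum_(k | `[< eq_up_to_phase (output A k) C0 >])
     abs2 (final_state A U k ord0).

End QuantumDefs.

(* Main.v *)
Require Import Defs.
From HB Require Import structures.
From mathcomp Require Import all_boot all_order all_algebra.
From mathcomp Require Import complex mxtens.
From mathcomp Require Import boolp reals exp.
From mathcomp Require Import sequences spectral ring lra zify.
Import Order.TTheory GRing.Theory Num.Theory.
Local Open Scope ring_scope.

Set Implicit Arguments. Unset Strict Implicit. Unset Printing Implicit Defensive.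

(** Let [C] be the Clifford close to [U].  Since the entrywise conjugate of a
    Clifford is that Clifford times a Pauli matrix (up to phase), [C P C^T] is
    a Pauli matrix for every Pauli matrix [P].  Applying [U] to both halves of
    the Bell state [P] and measuring in the Bell basis returns the label of
    [C P C^T] with probability at least [(1 - 2 eps^2)^2 >= 9/16], so the
    majority over [O(log (n / delta))] repetitions is correct except with
    probability [O(delta / n)].  Doing this for [P = 1] and the [2n] generators
    [X_l, Z_l] determines [C] up to a Pauli matrix on the right.  If [G] is any
    Clifford with the same labels, this last Pauli matrix [G^dagger C] is the
    likely outcome of measuring the Choi state of [U] in the Bell basis rotated
    by [G].  When [n = 1] and [delta] is close to 1 the query budget may be
    less than one query, but a uniformly random guess is then good enough. *)

(** * Adjoints, unitaries, and extension of isometries to unitaries *)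

Section Adjoint.
Variable R : realType.
Local Notation C := (R[i]).

Lemma adjE m n (A : 'M[C]_(m, n)) i j : adj A i j = conjc (A j i).
Proof. by rewrite !mxE. Qed.

Lemma adjK m n (A : 'M[C]_(m, n)) : adj (adj A) = A.
Proof. by apply/matrixP => i j; rewrite !adjE conjcK. Qed.

Lemma adjM m n p (A : 'M[C]_(m, n)) (B : 'M[C]_(n, p)) :
  adj (A *m B) = adj B *m adj A.
Proof. by rewrite /adj map_mxM trmx_mul. Qed.

Lemma adjD m n (A B : 'M[C]_(m, n)) : adj (A + B) = adj A + adj B.
Proof. by rewrite /adj map_mxD linearD. Qed.

Lemma adj_scale m n (z : C) (A : 'M[C]_(m, n)) : adj (z *: A) = conjc z *: adj A.
Proof. by apply/matrixP => i j; rewrite !mxE rmorphM. Qed.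

Lemma adj1 n : adj (1%:M : 'M[C]_n) = 1%:M.
Proof. by rewrite /adj map_mx1 trmx1. Qed.

Lemma adj0 m n : adj (0 : 'M[C]_(m, n)) = 0.
Proof. by rewrite /adj map_mx0 trmx0. Qed.

Lemma mxtrace_adj n (A : 'M[C]_n) : \tr (adj A) = conjc (\tr A).
Proof. by rewrite rmorph_sum; apply: eq_bigr => i _; rewrite adjE. Qed.

Lemma unitaryP d (U : 'M[C]_d) : unitary U <-> adj U *m U = 1%:M.
Proof. by split=> /mulmx1C. Qed.

Lemma unitaryM d (U V : 'M[C]_d) : unitary U -> unitary V -> unitary (U *m V).
Proof.
move=> uU uV.
by rewrite /unitary adjM mulmxA -(mulmxA U) uV mulmx1.
Qed.

Lemma unitary1 d : unitary (1%:M : 'M[C]_d).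
Proof. by rewrite /unitary adj1 mulmx1. Qed.

Lemma unitary_adj d (U : 'M[C]_d) : unitary U -> unitary (adj U).
Proof. by move/unitaryP => uU; rewrite /unitary adjK. Qed.

Lemma unitary_tr d (U : 'M[C]_d) : unitary U -> unitary U^T.
Proof.
move/unitaryP => uU; rewrite /unitary.
have -> : adj U^T = (adj U)^T by apply/matrixP => i j; rewrite !mxE.
by rewrite -trmx_mul uU trmx1.
Qed.

Lemma adj_tstar m n (A : 'M[C]_(m, n)) : adj A = map_mx Num.conj A^T.
Proof. by rewrite /adj map_trmx. Qed.

(** Gram-Schmidt on a basis of the orthogonal complement of the columns of [A] supplies the columns
    of [S]. *)
Lemma orthonormal_complement m N (A : 'M[C]_(N, m)) : adj A *m A = 1%:M ->
  exists S : 'M[C]_(N, N - m),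
    [/\ adj S *m S = 1%:M, adj A *m S = 0 & A *m adj A + S *m adj S = 1%:M].
Proof.
move=> AA.
have uA : (adj A) \is unitarymx.
  by apply/unitarymxP; rewrite -adj_tstar adjK.
have rA := mxrank_unitary uA.
have le_mN : (m <= N)%N by rewrite -{1}rA rank_leq_col.
pose O := orthomx Num.conj 1%:M (adj A).
have eO : \rank O = (N - m)%N by rewrite rank_ortho rA.
pose S0 := schmidt (row_base O).
have uS0 : S0 \is unitarymx by apply: schmidt_unitarymx; rewrite rank_leq_col.
have orthS0 : (S0 <= O)%MS.
  by rewrite /S0 (eqmx_schmidt_free (row_base_free _)) eq_row_base.
have [S [uS oS]] : exists S : 'M[C]_(N - m, N),
    S \is unitarymx /\ (S <= O)%MS.
  by move: S0 uS0 orthS0; rewrite eO => S0 ? ?; exists S0.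
exists (adj S).
have S1 : adj (adj S) *m adj S = 1%:M.
  by rewrite adjK adj_tstar; apply/unitarymxP.
have S2 : adj A *m adj S = 0.
  have /orthomx1P := oS; rewrite -adj_tstar adjK => SA.
  by rewrite -adjM SA adj0.
split=> //; move: (adj S) S1 S2 => {S oS uS S0 uS0 orthS0 eO O uA rA} S S1 S2.
(* Replacing [N] by [m + (N - m)] makes [row_mx A S] square, so its left inverse is also a right
   inverse. *)
have e : (m + (N - m) = N)%N by rewrite subnKC.
move: {le_mN} (N - m)%N e S S1 S2 => k e.
case: N / e A AA => A AA S S1 S2.
have S3 : adj S *m A = 0 by rewrite -[LHS]adjK adjM adjK S2 adj0.
have adjrow : adj (row_mx A S) = col_mx (adj A) (adj S).
  by rewrite /adj map_row_mx tr_row_mx.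
rewrite -mul_row_col -adjrow; apply: mulmx1C.
by rewrite adjrow mul_col_row AA S1 S2 S3 -scalar_mx_block.
Qed.

(** [W] carries the columns of [A] to those of [B] and one orthonormal complement to the other. *)
Lemma unitary_extension m N (A B : 'M[C]_(N, m)) :
  adj A *m A = 1%:M -> adj B *m B = 1%:M ->
  exists2 W, unitary W & W *m A = B.
Proof.
move=> AA BB.
have [S [S1 S2 S3]] := orthonormal_complement AA.
have [S' [S1' S2' S3']] := orthonormal_complement BB.
have S4 : adj S *m A = 0 by rewrite -[LHS]adjK adjM adjK S2 adj0.
exists (B *m adj A + S' *m adj S).
  rewrite /unitary adjD !adjM !adjK mulmxDl !mulmxDr.
  rewrite -!mulmxA !(mulmxA (adj A)) !(mulmxA (adj S)) AA S1 S2 S4.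
  by rewrite !(mul0mx, mul1mx, mulmx0) addr0 add0r.
by rewrite mulmxDl -!mulmxA AA S4 mulmx0 mulmx1 addr0.
Qed.

(** Kernels indexed by finite types, rather than matrices, let product types serve directly as
    registers. *)
Definition isometric (S T : finType) (A : T -> S -> C) :=
  forall s s' : S, \sum_t conjc (A t s) * A t s' = (s == s')%:R.

Lemma isometric_extension N (T : finType) (A B : 'I_N -> T -> C) :
  isometric A -> isometric B ->
  exists2 W : 'M[C]_N, unitary W &
    forall i t, \sum_j W i j * A j t = B i t.
Proof.
pose M (F : 'I_N -> T -> C) := \matrix_(i < N, k < #|T|) F i (enum_val k).
have MM F : isometric F -> adj (M F) *m M F = 1%:M.
  move=> iF; apply/matrixP => k l; rewrite !mxE -(inj_eq enum_val_inj) -iF.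
  by apply: eq_bigr => i _; rewrite !mxE.
move=> /MM AA /MM BB; have [W uW WA] := unitary_extension AA BB.
exists W => // i t; have /matrixP/(_ i (enum_rank t)) := WA.
rewrite !mxE enum_rankK => <-.
by apply: eq_bigr => j _; rewrite !mxE enum_rankK.
Qed.

Lemma isometric_inj (S T : finType) (J : S -> T) : injective J ->
  isometric (fun t s => (t == J s)%:R).
Proof.
move=> injJ s s'; rewrite (bigD1 (J s)) //= eqxx conjc1 mul1r (inj_eq injJ).
by rewrite big1 ?addr0 // => t /negPf ->; rewrite conjc0 mul0r.
Qed.

Lemma isometric_comp (S T V : finType) (B : V -> T -> C) (A : T -> S -> C) :
  isometric B -> isometric A ->
  isometric (fun v s => \sum_t B v t * A t s).
Proof.
move=> iB iA s s'; rewrite -iA.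
under eq_bigr do rewrite rmorph_sum /= big_distrlr /=.
rewrite exchange_big /=; apply: eq_bigr => t _.
rewrite exchange_big /= (bigD1 t) //= [X in _ + X]big1 ?addr0 => [|t' /negPf nt].
  under eq_bigr do rewrite rmorphM mulrACA /=.
  by rewrite -mulr_suml iB eqxx mul1r.
under eq_bigr do rewrite rmorphM mulrACA /=.
by rewrite -mulr_suml iB eq_sym nt mul0r.
Qed.

End Adjoint.

(** * States that can be prepared with a given number of queries *)

Section StatePreparation.
Variables (R : realType) (n : nat).
Local Notation C := (R[i]).
Local Notation dim a := (2 ^ n * 2 ^ a)%N.

Definition zero_state a : 'cV[C]_(dim a) :=
  \col_k (if val k == 0%N then 1 else 0).

Definition run a (V0 : 'M[C]_(dim a)) (Vs : seq 'M[C]_(dim a))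
    (U : 'M[C]_(2 ^ n)) : 'cV[C]_(dim a) :=
  foldl (fun v V => V *m (oracle a U *m v)) (V0 *m zero_state a) Vs.

(** Embeds a state on the abstract register [T] into the machine space; amplitudes vanish off the
    image of [J]. *)
Definition push a (T : finType) (J : T -> 'I_(dim a)) (phi : T -> C) :
  'cV[C]_(dim a) := \col_i \sum_t (i == J t)%:R * phi t.

(* Asking for every large ancilla register and every placement [J] of the basis
   states makes reindexing and adding ancillas trivial. *)
Definition prepares q (T : finType) (Phi : 'M[C]_(2 ^ n) -> T -> C) : Prop :=
  exists a0, forall a, (a0 <= a)%N ->
  forall J : T -> 'I_(dim a), injective J ->
  exists V0 Vs, [/\ unitary V0, {in Vs, forall V, unitary V}, size Vs = q &
    forall U, run V0 Vs U = push J (Phi U)].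

Lemma pushE a (T : finType) (J : T -> 'I_(dim a)) phi t : injective J ->
  push J phi (J t) 0 = phi t.
Proof.
move=> injJ; rewrite mxE (bigD1 t) //= eqxx mul1r big1 ?addr0 // => s nst.
by rewrite (inj_eq injJ) eq_sym (negPf nst) mul0r.
Qed.

Lemma zero_stateE a : exists2 J : unit -> 'I_(dim a),
  injective J & zero_state a = push J (fun=> 1).
Proof.
have dim_gt0 : (0 < dim a)%N by rewrite muln_gt0 !expn_gt0.
exists (fun=> Ordinal dim_gt0) => [[] [] //|].
apply/matrixP => i j; rewrite !mxE (big_pred1 tt) => [|[]//].
by rewrite -val_eqE /= mulr1; case: eqP.
Qed.

(** Both the placement [J] and [A] followed by [J'] are isometries from [T] into the machine space,
    so some unitary carries the first to the second. *)
Lemma mul_push a (T T' : finType) (J : T -> 'I_(dim a)) (J' : T' -> 'I_(dim a))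
    (A : T' -> T -> C) : injective J -> injective J' -> isometric A ->
  exists2 W, unitary W & forall phi,
    W *m push J phi = push J' (fun t' => \sum_t A t' t * phi t).
Proof.
move=> injJ injJ' iA.
have [W uW WE] := isometric_extension (isometric_inj R injJ)
  (isometric_comp (isometric_inj R injJ') iA).
exists W => // phi; apply/matrixP => i k; rewrite !mxE.
under eq_bigr do rewrite mxE mulr_sumr.
rewrite exchange_big /=.
under eq_bigr => t _ do
  (under eq_bigr do rewrite mulrA; rewrite -mulr_suml WE mulr_suml).
rewrite exchange_big /=; apply: eq_bigr => t' _.
by rewrite mulr_sumr; apply: eq_bigr => t _; rewrite mulrA.
Qed.

(** [W] is merged into the last gate, so it costs no query. *)
Lemma run_mul a (V0 W : 'M[C]_(dim a)) Vs : unitary V0 ->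
    {in Vs, forall V, unitary V} -> unitary W ->
  exists V0' Vs', [/\ unitary V0', {in Vs', forall V, unitary V},
    size Vs' = size Vs & forall U, run V0' Vs' U = W *m run V0 Vs U].
Proof.
move=> u0; case/lastP: Vs => [|Vs V] us uW.
  exists (W *m V0), [::]; split=> //; first exact: unitaryM.
  by move=> U; rewrite /run /= mulmxA.
exists V0, (rcons Vs (W *m V)); split=> // [V'||U].
- rewrite mem_rcons inE => /orP[/eqP->|V's].
    by apply: unitaryM => //; apply: us; rewrite mem_rcons mem_head.
  by apply: us; rewrite mem_rcons inE V's orbT.
- by rewrite !size_rcons.
- by rewrite /run !foldl_rcons -!mulmxA.
Qed.

Lemma inj_into_dim a (T : finType) : (#|T| <= a)%N ->
  exists J : T -> 'I_(dim a), injective J.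
Proof.
move=> leTa.
have le : (#|T| <= dim a)%N.
  apply: (leq_trans leTa); apply: (leq_trans (ltnW (ltn_expl a (ltnSn 1)))).
  by rewrite leq_pmull ?expn_gt0.
exists (fun t => widen_ord le (enum_rank t)) => s t.
by move=> /(congr1 val) /= /ord_inj /enum_rank_inj.
Qed.

(** A unit vector is an isometry out of a one-point register, and the initial state is such a
    register. *)
Lemma prepares_const (T : finType) (phi : T -> C) :
  \sum_t conjc (phi t) * phi t = 1 -> prepares 0 (fun=> phi).
Proof.
move=> phi1; exists 0%N => a _ J injJ; have [J0 injJ0 J0E] := zero_stateE a.
have [W uW WE] := @mul_push a _ _ J0 J (fun t _ => phi t) injJ0 injJ
  ltac:(by move=> [] []; rewrite phi1).
exists W, [::]; split=> // U; rewrite /run /= J0E WE.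
by congr push; apply/funext => t; rewrite (big_pred1 tt) ?mulr1 // => -[].
Qed.

Lemma prepares_isometric q (T T' : finType) Phi (A : T' -> T -> C) :
  isometric A -> prepares q Phi ->
  prepares q (fun U t' => \sum_t A t' t * Phi U t).
Proof.
(* The extra [#|T|] ancillas guarantee room for the input register before [A] is applied. *)
move=> iA [a0 prep]; exists (a0 + #|T|)%N => a le_a J' injJ'.
have [J injJ] := @inj_into_dim a T (leq_trans (leq_addl _ _) le_a).
have [V0 [Vs [u0 us sz runE]]] := prep a (leq_trans (leq_addr _ _) le_a) J injJ.
have [W uW WE] := mul_push injJ injJ' iA.
have [V0' [Vs' [u0' us' sz' runE']]] := run_mul u0 us uW.
exists V0', Vs'; split=> // [|U]; first by rewrite sz' sz.
by rewrite runE' runE WE.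
Qed.

Lemma prepares_reindex q (T T' : finType) Phi (g : T' -> T) (h : T -> T') :
  cancel g h -> cancel h g -> prepares q Phi ->
  prepares q (fun U t' => Phi U (g t')).
Proof.
move=> gK hK [a0 prep]; exists a0 => a le_a J' injJ'.
have injJ : injective (J' \o h) by apply: inj_comp => //; apply: can_inj hK.
have [V0 [Vs [u0 us sz runE]]] := prep a le_a _ injJ.
exists V0, Vs; split=> // U; rewrite runE; apply/matrixP => i k; rewrite !mxE.
rewrite [RHS](reindex h) /=; last by exists g => x _; rewrite ?gK ?hK.
by apply: eq_bigr => t _; rewrite hK.
Qed.

Lemma prepares_ext q (T : finType) Phi Psi :
  (forall U t, Phi U t = Psi U t) ->
  @prepares q T Phi -> @prepares q T Psi.
Proof. by move=> PhiE; congr prepares; do 2!apply/funext=> ?; apply: PhiE. Qed.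

(** The oracle acts on the first tensor factor of the machine space, so the state is first placed by
    [J1] along the tensor structure; the gate after the query moves it to the requested
    placement. *)
Lemma prepares_query q (S : finType) Phi :
  @prepares q ('I_(2 ^ n) * S)%type Phi ->
  @prepares q.+1 ('I_(2 ^ n) * S)%type
    (fun U x => \sum_j U x.1 j * Phi U (j, x.2)).
Proof.
move=> [a0 prep]; exists (a0 + #|S|)%N => a le_a J injJ.
have le_S : (#|S| <= 2 ^ a)%N.
  apply: (@leq_trans a); first exact: leq_trans (leq_addl _ _) le_a.
  exact: ltnW (ltn_expl a (ltnSn 1)).
pose h s : 'I_(2 ^ a) := widen_ord le_S (enum_rank s).
have injh : injective h.
  by move=> s t /(congr1 val) /= /ord_inj /enum_rank_inj.
pose J1 (x : 'I_(2 ^ n) * S) : 'I_(dim a) := mxtens_index (x.1, h x.2).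
have injJ1 : injective J1.
  move=> [i s] [j t] /(congr1 (@mxtens_unindex _ _)).
  by rewrite !mxtens_indexK => /eqP; rewrite xpair_eqE => /andP[/eqP /= -> /eqP/injh ->].
have [V0 [Vs [u0 us sz runE]]] := prep a (leq_trans (leq_addr _ _) le_a) J1 injJ1.
have [W uW WE] := mul_push injJ1 injJ (isometric_inj R (@inj_id _)).
exists V0, (rcons Vs W); split=> // [V||U].
- by rewrite mem_rcons inE => /orP[/eqP->//|]; apply: us.
- by rewrite size_rcons sz.
rewrite /run foldl_rcons -/(run _ _ _) runE.
have -> : oracle a U *m push J1 (Phi U) =
    push J1 (fun x => \sum_j U x.1 j * Phi U (j, x.2)).
  apply/matrixP => k l; rewrite !mxE; case: (mxtens_indexP k) => i b.
  under eq_bigr do rewrite [push _ _ _ _]mxE mulr_sumr.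
  rewrite exchange_big /=.
  transitivity (\sum_x U i x.1 * (b == h x.2)%:R * Phi U (x.1, x.2)).
    apply: eq_bigr => x _; rewrite (bigD1 (J1 x)) //= eqxx mul1r.
    rewrite big1 ?addr0 => [|y /negPf ->]; last by rewrite mul0r mulr0.
    by rewrite tensmxE !mxE -surjective_pairing.
  rewrite -(pair_bigA _ (fun j s => U i j * (b == h s)%:R * Phi U (j, s))) /=.
  pose G i' s := (mxtens_index (i, b) == J1 (i', s))%:R *
    (\sum_j U i' j * Phi U (j, s)).
  rewrite [RHS](eq_bigr (fun x => G x.1 x.2)) => [|[]//].
  rewrite -(pair_bigA _ G) /G /=.
  rewrite [RHS](bigD1 i) //= [X in _ = _ + X]big1 ?addr0 => [|i' ne_i].
    rewrite exchange_big /=; apply: eq_bigr => s _; rewrite mulr_sumr.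
    apply: eq_bigr => j _; rewrite mulrAC [RHS]mulrC; congr (_ * _%:R).
    congr nat_of_bool; apply/eqP/eqP => [-> //|].
    by move/(congr1 (@mxtens_unindex _ _)); rewrite !mxtens_indexK => -[].
  apply: big1 => s _; case: eqP => [|_]; last by rewrite mul0r.
  move/(congr1 (@mxtens_unindex _ _)); rewrite !mxtens_indexK => -[ii' _].
  by rewrite ii' eqxx in ne_i.
rewrite WE; congr push; apply/funext => x.
rewrite (bigD1 x) //= eqxx mul1r [X in _ + X]big1 ?addr0 // => y.
by rewrite eq_sym => /negPf ->; rewrite mul0r.
Qed.

(** Measured indices in the image of [J] account for the left-hand sum; all others contribute
    nonnegative terms, whence an inequality. *)
Lemma prepares_query_alg q (T : finType) Phi (out : T -> 'M[C]_(2 ^ n)) :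
  @prepares q T Phi -> exists2 A : query_alg R n, nq A = q &
    forall U C0, \sum_(t | `[< eq_up_to_phase (out t) C0 >]) abs2 (Phi U t)
      <= success_prob A U C0.
Proof.
move=> [a0 prep]; pose a := (a0 + #|T|)%N.
have [J injJ] := @inj_into_dim a T (leq_addl _ _).
have [V0 [Vs [u0 us sz runE]]] := prep a (leq_addr _ _) J injJ.
pose gate (t : 'I_q.+1) := nth V0 (V0 :: Vs) t.
have uG t : unitary (gate t).
  rewrite /gate; case: t => -[|t] /= lt_t //.
  by apply: us; rewrite mem_nth // sz.
pose outk k := if [pick t | k == J t] is Some t then out t else 0.
exists (QueryAlg uG outk) => // U C0; rewrite /success_prob /=.
have fE : final_state (QueryAlg uG outk) U = push J (Phi U).
  have VsE : Vs = [seq gate t | t <- behead (enum 'I_q.+1)].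
    rewrite -behead_map (map_comp (nth V0 (V0 :: Vs)) val) val_enum_ord /= -sz.
    by rewrite (iotaDl 1 0) -map_comp /= map_nth_iota0 // take_size.
  rewrite -runE /final_state /run [in RHS]VsE.
  by elim: (behead _) (V0 *m _) => //= t ts IH v; rewrite IH.
have outE t : outk (J t) = out t.
  rewrite /outk; case: pickP => [s /eqP/injJ -> //|/(_ t)].
  by rewrite eqxx.
rewrite [leRHS](bigID (fun k => [exists t, k == J t])) /=.
rewrite -[leLHS]addr0 lerD //; last first.
  by apply: sumr_ge0 => k _; rewrite addr_ge0 // sqr_ge0.
rewrite (eq_bigr (fun t => abs2 (final_state (QueryAlg uG outk) U (J t) 0))).
  rewrite -big_set /=.
  rewrite -(big_imset (fun k => abs2 (final_state (QueryAlg uG outk) U k 0))).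
    rewrite le_eqVlt; apply/orP; left; apply/eqP; apply: eq_bigl => k.
    apply/imsetP/andP => [[t]|[outk0 /existsP[t /eqP kJ]]].
      rewrite inE => outt ->; rewrite outE; split=> //.
      by apply/existsP; exists t.
    by exists t => //; rewrite inE -outE -kJ.
  exact: in2W.
by move=> t _; rewrite fE pushE.
Qed.

End StatePreparation.

(** * Pauli matrices: labels, commutation signs, and expansion of matrices *)

Section PauliMatrices.
Variable R : realType.
Local Notation C := (R[i]).

(** Labels for [k.+1] qubits, nested like [pauli_tens_rec] so that dimensions agree by
    conversion. *)
Fixpoint plabel (k : nat) : finType :=
  if k is k'.+1 then ('I_4 * plabel k')%type else 'I_4.

Fixpoint pauli k : plabel k -> 'M[C]_(2 ^ k.+1) :=
  match k with
  | 0 => @sigma R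
  | k'.+1 => fun b => sigma R b.1 *t pauli b.2
  end.

Fixpoint pzero k : plabel k := if k is k'.+1 then (ord0, pzero k') else ord0.

(** The symplectic form on labels: one-qubit Paulis anticommute when they are distinct and neither
    is the identity, and the signs multiply over the qubits. *)
Fixpoint anticommutes k : plabel k -> plabel k -> bool :=
  match k with
  | 0 => fun a b : 'I_4 => [&& a != ord0, b != ord0 & a != b]
  | k'.+1 => fun a b =>
      [&& a.1 != ord0, b.1 != ord0 & a.1 != b.1] (+) anticommutes a.2 b.2
  end.

Local Notation o4 i := (@Ordinal 4 i isT).
Local Notation X4 := (o4 1).
Local Notation Z4 := (o4 3).

Fixpoint pgens k : seq (plabel k) :=
  match k with
  | 0 => [:: X4; Z4]
  | k'.+1 => [:: (X4, pzero k'), (Z4, pzero k') & [seq (ord0, g) | g <- pgens k']]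
  end.

Lemma size_pgens k : size (pgens k) = k.+1.*2.
Proof. by elim: k => //= k IH; rewrite size_map IH !doubleS. Qed.

Lemma ord4P (P : 'I_4 -> Prop) :
  P (o4 0) -> P (o4 1) -> P (o4 2) -> P (o4 3) -> forall a, P a.
Proof.
by move=> P0 P1 P2 P3 [[|[|[|[|//]]]] lt4]; rewrite (bool_irrelevance lt4 isT).
Qed.

Lemma anticommutes_pzero k (b : plabel k) : anticommutes b (pzero k) = false.
Proof. by elim: k b => [|k IH] b /=; rewrite ?IH andbF. Qed.

Lemma ord4_sep (a b : 'I_4) :
  (forall c, c \in [:: X4; Z4] ->
    [&& a != ord0, c != ord0 & a != c] = [&& b != ord0, c != ord0 & b != c]) ->
  a = b.
Proof.
move=> H; move: (H X4 (mem_head _ _)) (H Z4 (mem_last X4 [:: Z4])) => {H}.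
by move: a b; apply: ord4P; apply: ord4P.
Qed.

(** Nondegeneracy of the symplectic form: on each qubit, the signs against X and Z tell the four
    Paulis apart. *)
Lemma pgens_sep k (a b : plabel k) :
  {in pgens k, forall g, anticommutes a g = anticommutes b g} -> a = b.
Proof.
elim: k a b => [|k IH] a b H; first exact: ord4_sep.
case: a b H => [a1 a2] [b1 b2] H; congr (_, _).
  apply: ord4_sep => c; rewrite !inE => c_in.
  have /H /= : (c, pzero k) \in pgens k.+1.
    by case/orP: c_in => /eqP ->; rewrite !inE eqxx ?orbT.
  by rewrite !anticommutes_pzero !addbF.
apply: IH => g g_in.
have /H /= : (ord0, g) \in pgens k.+1.
  by rewrite !inE map_f ?orbT.
by rewrite !andbF.
Qed.

Lemma pauli_of_tens k s : exists b, pauli_tens_rec R k s = @pauli k b.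
Proof.
elim: k => [|k [b IH]] /=; first by exists (s 0%N).
by exists (s k.+1, b); rewrite IH.
Qed.

Lemma pauli_tens_ext k s s' : (forall l, (l <= k)%N -> s l = s' l) ->
  pauli_tens_rec R k s = pauli_tens_rec R k s'.
Proof.
elim: k => [|k IH] /= ss'; first by rewrite ss'.
by rewrite ss' // IH // => l le_lk; rewrite ss' // ltnW.
Qed.

Lemma pauli_to_tens k b : exists s, pauli_tens_rec R k s = @pauli k b.
Proof.
elim: k b => [|k IH] b; first by exists (fun=> b).
have [s sE] := IH b.2.
exists (fun l => if l == k.+1 then b.1 else s l) => /=.
rewrite eqxx -sE; congr (_ *t _); apply: pauli_tens_ext => l le_lk.
by rewrite ltn_eqF.
Qed.

Lemma pauli_groupP k (P : 'M[C]_(2 ^ k.+1)) :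
  pauli_group P <-> exists l b, P = 'i%C ^+ l *: @pauli k b.
Proof.
split=> [[l [s ->]]|[l [b ->]]].
  by have [b sE] := pauli_of_tens k s; exists l, b; rewrite -sE.
by have [s sE] := pauli_to_tens b; exists l, s; rewrite -sE.
Qed.

Lemma adj_tens m n p q (A : 'M[C]_(m, n)) (B : 'M[C]_(p, q)) :
  adj (A *t B) = adj A *t adj B.
Proof. by rewrite /adj map_mxT trmx_tens. Qed.

Lemma tens1 m n : (1%:M : 'M[C]_m) *t (1%:M : 'M[C]_n) = 1%:M.
Proof.
apply/matrixP => i j; case: (mxtens_indexP i) => i1 i2.
case: (mxtens_indexP j) => j1 j2; rewrite tensmxE !mxE -natrM mulnb -xpair_eqE.
by rewrite (can_eq (@mxtens_indexK _ _)).
Qed.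

Lemma tensZ m n p q (y z : C) (A : 'M[C]_(m, n)) (B : 'M[C]_(p, q)) :
  (y *: A) *t (z *: B) = (y * z) *: (A *t B).
Proof. by apply/matrixP => i j; rewrite !mxE mulrACA. Qed.


Lemma mx2P (M N : 'M[C]_2) :
  M 0 0 = N 0 0 -> M 0 1 = N 0 1 -> M 1 0 = N 1 0 -> M 1 1 = N 1 1 -> M = N.
Proof.
move=> e00 e01 e10 e11; apply/matrixP => i j.
have o2 (x : 'I_2) : x = 0 \/ x = 1.
  by case: x => -[|[|//]] ?; [left|right]; apply: val_inj.
by case: (o2 i) => ->; case: (o2 j) => ->.
Qed.

Ltac sigma_table :=
  apply: mx2P; rewrite ?mxE ?big_ord_recl ?big_ord0 /= ?mxE /=; apply/eqP;
  rewrite eq_complex /= ?mxE /=; apply/andP; split; apply/eqP; ring.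

Lemma sigma_herm a : adj (sigma R a) = sigma R a.
Proof. move: a; apply: ord4P; rewrite /sigma /=; sigma_table. Qed.


Lemma sigma_sq a : sigma R a *m sigma R a = 1%:M.
Proof. move: a; apply: ord4P; rewrite /sigma /=; sigma_table. Qed.

Lemma sigma_conj a : exists e : bool,
  map_mx (@conjc R) (sigma R a) = (-1) ^+ e *: sigma R a.
Proof.
move: a; apply: ord4P;
  (* Only Y has imaginary entries, so only it changes sign. *)
  [exists false|exists false|exists true|exists false];
  rewrite /sigma /=; sigma_table.
Qed.

Lemma sigma_comm a b : sigma R a *m sigma R b =
  (-1) ^+ [&& a != ord0, b != ord0 & a != b] *: (sigma R b *m sigma R a).
Proof.
move: a b; apply: ord4P; apply: ord4P; rewrite /sigma /=; sigma_table.
Qed.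

Lemma sigma_mul a b : exists l c,
  sigma R a *m sigma R b = 'i%C ^+ l *: sigma R c.
Proof.
move: a b; apply: ord4P; apply: ord4P;
  (* The one-qubit multiplication table, row by row: exponent of ['i] and resulting label. *)
  [exists 0%N, (o4 0)|exists 0%N, (o4 1)|exists 0%N, (o4 2)|exists 0%N, (o4 3)
  |exists 0%N, (o4 1)|exists 0%N, (o4 0)|exists 1%N, (o4 3)|exists 3%N, (o4 2)
  |exists 0%N, (o4 2)|exists 3%N, (o4 3)|exists 0%N, (o4 0)|exists 1%N, (o4 1)
  |exists 0%N, (o4 3)|exists 1%N, (o4 2)|exists 3%N, (o4 1)|exists 0%N, (o4 0)];
  rewrite /sigma /= ?expr0 ?expr1 ?exprS; sigma_table.
Qed.

Lemma sigma_complete (i j k l : 'I_2) :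
  \sum_a sigma R a i j * conjc (sigma R a k l) =
  2 * ((i == k)%:R * (j == l)%:R).
Proof.
have o2 (x : 'I_2) : x = 0 \/ x = 1.
  by case: x => -[|[|//]] ?; [left|right]; apply: val_inj.
rewrite !big_ord_recl big_ord0.
case: (o2 i) => ->; case: (o2 j) => ->; case: (o2 k) => ->; case: (o2 l) => ->;
 rewrite /sigma /= ?mxE /=; apply/eqP;
  rewrite eq_complex /= ?mxE /=; apply/andP; split; apply/eqP; ring.
Qed.

Lemma pauli_herm k b : adj (@pauli k b) = pauli b.
Proof.
elim: k b => [|k IH] b /=; first exact: sigma_herm.
by rewrite adj_tens IH sigma_herm.
Qed.

Lemma pauli_sq k b : @pauli k b *m pauli b = 1%:M.
Proof.
elim: k b => [|k IH] b /=; first exact: sigma_sq.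
by rewrite tensmx_mul IH sigma_sq tens1.
Qed.

Lemma pauli_conj k b : exists e : bool,
  map_mx (@conjc R) (@pauli k b) = (-1) ^+ e *: pauli b.
Proof.
elim: k b => [|k IH] b /=; first exact: sigma_conj.
have [e1 E1] := sigma_conj b.1; have [e2 E2] := IH b.2.
by exists (e1 (+) e2); rewrite map_mxT E1 E2 tensZ signr_addb.
Qed.

Lemma pauli_comm k a b :
  @pauli k a *m pauli b = (-1) ^+ anticommutes a b *: (pauli b *m pauli a).
Proof.
elim: k a b => [|k IH] a b /=; first exact: sigma_comm.
by rewrite !tensmx_mul IH sigma_comm tensZ signr_addb.
Qed.

Lemma pauli_mul k a b : exists l c,
  @pauli k a *m pauli b = 'i%C ^+ l *: pauli c.
Proof.
elim: k a b => [|k IH] a b /=; first exact: sigma_mul.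
have [l1 [c1 E1]] := sigma_mul a.1 b.1; have [l2 [c2 E2]] := IH a.2 b.2.
by exists (l1 + l2)%N, (c1, c2); rewrite tensmx_mul E1 E2 tensZ exprD.
Qed.

Lemma pauli_zero k : @pauli k (pzero k) = 1%:M.
Proof. by elim: k => //= k IH; rewrite IH /sigma /= tens1. Qed.

(** The completeness relation of an orthogonal matrix basis; it factors over the qubits. *)
Lemma pauli_complete k i j i' j' :
  \sum_a @pauli k a i j * conjc (pauli a i' j') =
  (2 ^ k.+1)%:R * ((i == i')%:R * (j == j')%:R).
Proof.
elim: k i j i' j' => [|k IH] i j i' j'; first exact: sigma_complete.
have -> : (2 ^ k.+2)%:R = 2 * (2 ^ k.+1)%:R :> C by rewrite expnS natrM.
case: (@mxtens_indexP 2 (2 ^ k.+1) i) => i1 i2.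
case: (@mxtens_indexP 2 (2 ^ k.+1) j) => j1 j2.
case: (@mxtens_indexP 2 (2 ^ k.+1) i') => i1' i2'.
case: (@mxtens_indexP 2 (2 ^ k.+1) j') => j1' j2'.
rewrite !(can_eq (@mxtens_indexK _ _)) !xpair_eqE -!mulnb !natrM.
transitivity (\sum_(a1 : 'I_4) \sum_(a2 : plabel k)
  (sigma R a1 i1 j1 * conjc (sigma R a1 i1' j1')) *
  (pauli a2 i2 j2 * conjc (pauli a2 i2' j2'))).
  rewrite pair_bigA; apply: eq_bigr => a _ /=.
  by rewrite !tensmxE rmorphM mulrACA.
under eq_bigr do rewrite -mulr_sumr IH.
by rewrite -mulr_suml sigma_complete; ring.
Qed.

Lemma pauli_expand k (W : 'M[C]_(2 ^ k.+1)) :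
  (2 ^ k.+1)%:R *: W = \sum_a \tr (pauli a *m W) *: @pauli k a.
Proof.
apply/matrixP => i j; rewrite mxE summxE.
transitivity (\sum_a \sum_i' \sum_j'
    W i' j' * (pauli a i j * conjc (@pauli k a i' j'))).
  rewrite exchange_big /= (bigD1 i) //= [X in _ + X]big1 ?addr0 => [|i' ni].
    rewrite exchange_big /= (bigD1 j) //= [X in _ + X]big1 ?addr0 => [|j' nj].
      by rewrite -mulr_sumr pauli_complete !eqxx !mulr1 mulrC.
    by rewrite -mulr_sumr pauli_complete (eq_sym j) (negPf nj) !mulr0.
  rewrite exchange_big /= big1 // => j' _.
  by rewrite -mulr_sumr pauli_complete (eq_sym i) (negPf ni) mul0r !mulr0.
apply: eq_bigr => a _; rewrite mxE -[in \tr _](pauli_herm a) /mxtrace.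
under [in RHS]eq_bigr do rewrite mxE.
rewrite exchange_big /= mulr_suml; apply: eq_bigr => i' _.
rewrite mulr_suml; apply: eq_bigr => j' _; rewrite adjE; ring.
Qed.

(* Comparing Pauli coefficients on both sides of [g W g = e W]: only labels [b]
   with [(-1)^(anticommutes b g) = e] for all [g] survive, and there is at most one. *)
Lemma pauli_of_commutation k (W : 'M[C]_(2 ^ k.+1)) :
  {in pgens k, forall g, exists e : C, pauli g *m W *m pauli g = e *: W} ->
  exists b z, W = z *: @pauli k b.
Proof.
move=> comW.
have coef g b : \tr (pauli b *m (pauli g *m W *m pauli g)) =
    (-1) ^+ anticommutes b g * \tr (pauli b *m W).
  rewrite 2!mulmxA pauli_comm -!scalemxAl mxtraceZ; congr (_ * _).
  by rewrite mxtrace_mulC !mulmxA pauli_sq mul1mx.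
case: (pickP (fun b => \tr (@pauli k b *m W) != 0)) => [b wb|w0]; last first.
  exists (pzero k), 0; apply: (@scalerI _ _ ((2 ^ k.+1)%:R : C)).
    by rewrite pnatr_eq0 expn_eq0.
  rewrite pauli_expand scale0r scaler0 big1 // => b _.
  by have /negbFE/eqP -> := w0 b; rewrite scale0r.
exists b, (((2 ^ k.+1)%:R)^-1 * \tr (pauli b *m W)).
rewrite -scalerA; apply: (canRL (scalerK _)).
  by rewrite pnatr_eq0 expn_eq0.
rewrite pauli_expand (bigD1 b) //= big1 ?addr0 // => b' nb'.
have [->|wb'] := eqVneq (\tr (pauli b' *m W)) 0; first by rewrite scale0r.
case/eqP: nb'; apply: pgens_sep => g /comW[e gW].
have eE c : \tr (pauli c *m W) != 0 -> (-1) ^+ anticommutes c g = e.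
  move=> wc; apply: (mulIf wc); rewrite -coef gW -scalemxAr mxtraceZ //.
by apply: (@signr_inj C); rewrite !eE.
Qed.

End PauliMatrices.

(** * Squared moduli and equality up to a global phase *)

Section Phases.
Variable R : realType.
Local Notation C := (R[i]).
Local Open Scope complex_scope.

Lemma abs2E (z : C) : (abs2 z)%:C = `|z| ^+ 2.
Proof. exact: add_Re2_Im2. Qed.

Lemma abs2_ge0 (z : C) : 0 <= abs2 z.
Proof. by rewrite addr_ge0 ?sqr_ge0. Qed.

Lemma abs2M (y z : C) : abs2 (y * z) = abs2 y * abs2 z.
Proof. by apply: (@complexI R); rewrite rmorphM /= !abs2E normrM exprMn. Qed.

Lemma phase_conj (z : C) : `|z| = 1 -> z * conjc z = 1.
Proof. by move=> z1; rewrite -sqr_normc z1 expr1n. Qed.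

Lemma eq_up_to_phase_sym d (A B : 'M[C]_d) :
  eq_up_to_phase A B -> eq_up_to_phase B A.
Proof.
move=> [z [z1 ->]]; exists (conjc z); split; first by rewrite normcJ.
by rewrite scalerA mulrC phase_conj // scale1r.
Qed.

Lemma eq_up_to_phase_trans d (A B D : 'M[C]_d) :
  eq_up_to_phase A B -> eq_up_to_phase B D -> eq_up_to_phase A D.
Proof.
move=> [y [y1 ->]] [z [z1 ->]]; exists (y * z).
by rewrite normrM y1 z1 mulr1 scalerA.
Qed.

(** Unitarity of both sides gives [|z|^2 = 1], read off at one diagonal entry. *)
Lemma unitary_phase d (A B : 'M[C]_d) z : (0 < d)%N ->
  unitary A -> unitary B -> A = z *: B -> `|z| = 1.
Proof.
move=> d_gt0 uA uB AE; move: uA; rewrite /unitary AE adj_scale -scalemxAl -scalemxAr.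
rewrite uB scalerA -sqr_normc => /matrixP/(_ (Ordinal d_gt0) (Ordinal d_gt0)).
rewrite !mxE eqxx mulr1 => /eqP; rewrite sqrp_eq1 ?normr_ge0 //.
by move/eqP.
Qed.

Lemma unitary_map_conj d (U : 'M[C]_d) :
  unitary U -> unitary (map_mx (@conjc R) U).
Proof. by move/unitary_adj/unitary_tr; rewrite /adj trmxK. Qed.

End Phases.

(** * How Cliffords act on Pauli matrices *)

Section CliffordAction.
Variables (R : realType) (k : nat).
Local Notation C := (R[i]).
Local Notation mat := 'M[C]_(2 ^ k.+1).
Local Notation pauli := (@pauli R k).
Local Notation cj := (map_mx (@conjc R)).

Definition is_pauli (P : mat) := exists b, eq_up_to_phase P (pauli b).

Lemma unitary_pauli b : unitary (pauli b).
Proof. by rewrite /unitary pauli_herm pauli_sq. Qed.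

Lemma clifford_pauli W b : clifford W -> is_pauli (W *m pauli b *m adj W).
Proof.
move=> [_ cW]; have /cW/pauli_groupP[l [c ->]] : pauli_group (pauli b).
  by apply/pauli_groupP; exists 0%N, b; rewrite expr0 scale1r.
exists c, ('i%C ^+ l); split=> //.
by rewrite normrX complexiE normCi expr1n.
Qed.

Lemma unitary_commutation (W : mat) : unitary W ->
  {in pgens k, forall g, exists e : C, W *m pauli g = e *: (pauli g *m W)} ->
  is_pauli W.
Proof.
move=> uW comW.
have [g /comW[e We]|b [z WE]] := @pauli_of_commutation R k W.
  by exists e; rewrite -mulmxA We -scalemxAr mulmxA pauli_sq mul1mx.
exists b, z; split=> //; apply: (unitary_phase _ uW (unitary_pauli b) WE).
by rewrite expn_gt0.
Qed.

(* [W] and its complex conjugate have the same conjugation action on Pauli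
   matrices up to signs, hence differ by a Pauli matrix. *)
Lemma clifford_congruence_pauli W b :
  clifford W -> is_pauli (W *m pauli b *m W^T).
Proof.
move=> cW; have [uW _] := cW; have /unitaryP uW' := uW.
pose D := adj W *m cj W.
have WD : W *m D = cj W by rewrite mulmxA uW mul1mx.
have [a Da] : is_pauli D.
  apply: unitary_commutation => [|g _].
    by apply: unitaryM; [apply: unitary_adj|apply: unitary_map_conj].
  have [c [z [z1 WgW]]] := clifford_pauli g cW.
  have [e1 E1] := pauli_conj R g; have [e2 E2] := pauli_conj R c.
  have WTE : W^T = cj (adj W) by apply/matrixP => i j; rewrite !mxE conjcK.
  have WTW : W^T *m cj W = 1%:M by rewrite WTE -map_mxM uW' map_mx1.
  (* Entrywise conjugation of [W g W^dagger = z c], with [c] a Pauli, changes only scalars, so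
     [cj W] and [W] act alike on [g] up to a factor. *)
  have gWE : cj W *m pauli g *m W^T =
      ((-1) ^+ e1 * (conjc z * (-1) ^+ e2 * conjc z)) *: (W *m pauli g *m adj W).
    have -> : cj W *m pauli g *m W^T = (-1) ^+ e1 *: cj (W *m pauli g *m adj W).
      rewrite !map_mxM E1 -scalemxAr -scalemxAl scalerA -signr_addb addbb scale1r.
      by rewrite -WTE.
    rewrite WgW map_mxZ E2 !scalerA.
    by rewrite -!mulrA (mulrC (conjc z) z) phase_conj // mulr1.
  exists ((-1) ^+ e1 * (conjc z * (-1) ^+ e2 * conjc z)).
  have /(congr1 (fun X => adj W *m X *m cj W)) := gWE.
  rewrite -!mulmxA WTW mulmx1 !mulmxA => ->.
  by rewrite -scalemxAr -scalemxAl !mulmxA uW' mul1mx.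
(* Now [W P W^T = W (P D^dagger) W^dagger], and [P D^dagger] is again a Pauli up to phase. *)
have -> : W^T = adj D *m adj W.
  by rewrite -adjM WD; apply/matrixP => i j; rewrite !mxE conjcK.
have [z [z1 DE]] := Da.
have [l [c bac]] := pauli_mul R b a.
have [c' Hc'] := clifford_pauli c cW; exists c'.
apply: eq_up_to_phase_trans Hc'; exists (conjc z * 'i%C ^+ l).
rewrite normrM normcJ z1 mul1r normrX complexiE normCi expr1n; split=> //.
rewrite DE adj_scale pauli_herm !mulmxA -scalemxAr -(mulmxA W (pauli b)) bac.
by rewrite -scalemxAr -!scalemxAl scalerA.
Qed.

(** Since [W g W^dagger = (W g W^T) (W W^T)^dagger], the identity label turns equality of
    congruences into equality of conjugations up to phase. Hence [adj W' *m W] commutes with each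
    generator up to a scalar. *)
Lemma same_labels_pauli (W W' : mat) : unitary W -> unitary W' ->
  {in pzero k :: pgens k, forall g,
    eq_up_to_phase (W *m pauli g *m W^T) (W' *m pauli g *m W'^T)} ->
  is_pauli (adj W' *m W).
Proof.
move=> uW uW' same; have /unitaryP uW1 := uW; have /unitaryP uW1' := uW'.
apply: unitary_commutation => [|g g_in].
  by apply: unitaryM => //; apply: unitary_adj.
have [z0 [_]] := same _ (mem_head _ _); rewrite pauli_zero !mulmx1 => E0.
have [|z [_ Eg]] := same g; first by rewrite inE g_in orbT.
exists (z * conjc z0).
have WgW (V : mat) : unitary V ->
    V *m pauli g *m adj V = V *m pauli g *m V^T *m adj (V *m V^T).
  move=> uV; rewrite adjM !mulmxA -(mulmxA _ V^T).
  by rewrite (unitary_tr uV) mulmx1.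
have := WgW W uW; rewrite Eg E0 adj_scale -scalemxAl -scalemxAr scalerA -WgW //.
move/(congr1 (fun X => adj W' *m X *m W)).
rewrite -!mulmxA uW1 mulmx1 mulmxA => ->.
by rewrite -scalemxAl -scalemxAr !mulmxA uW1' mul1mx.
Qed.

End CliffordAction.

(** * Overlap of the states obtained by querying both halves *)

Section Overlap.
Variables (R : realType).
Local Notation C := (R[i]).

(** Entrywise, this is [(|a| - |b|)^2 >= 0]. *)
Lemma trace_mul_le d (A B : 'M[C]_d) :
  `|\tr (A *m B)| * 2 <= \tr (A *m adj A) + \tr (B *m adj B).
Proof.
have trE (M : 'M[C]_d) : \tr (M *m adj M) = \sum_i \sum_j `|M i j| ^+ 2.
  apply: eq_bigr => i _; rewrite mxE; apply: eq_bigr => j _.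
  by rewrite adjE sqr_normc.
rewrite !trE [X in _ + X]exchange_big /= -big_split /=.
apply: (@le_trans _ _ ((\sum_i \sum_j `|A i j * B j i|) * 2)).
  rewrite ler_pM2r ?ltr0n //; apply: (le_trans (ler_norm_sum _ _ _)).
  by apply: ler_sum => i _; rewrite mxE ler_norm_sum.
rewrite mulr_suml; apply: ler_sum => i _.
rewrite mulr_suml -big_split /=; apply: ler_sum => j _.
rewrite normrM -subr_ge0 (_ : _ - _ = (`|A i j| - `|B j i|) ^+ 2); last by ring.
by rewrite real_exprn_even_ge0 // rpredB // normr_real.
Qed.

(** Split [W = V + w] with [V] traceless. The cross terms vanish, the scalar part contributes [w^2],
    and the [V] part has modulus at most [1 - |w|^2]. So [|s| >= 2 |w|^2 - 1 >= 3/4]. *)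
Lemma conj_trace_ge d (P W : 'M[C]_d) : (0 < d)%N ->
  unitary P -> unitary W -> 7 / 8 <= abs2 (\tr W / d%:R) ->
  9 / 16 <= abs2 (\tr (adj P *m W *m P *m W^T) / d%:R).
Proof.
move=> d_gt0 uP uW; set w := \tr W / d%:R; set s := _ / d%:R => w_ge.
have d0 : (d%:R : C) != 0 by rewrite pnatr_eq0 -lt0n.
have wd : w * d%:R = \tr W by rewrite /w divfK.
have [V WE trV] : exists2 V, W = V + w%:M & \tr V = 0.
  exists (W - w%:M); first by rewrite subrK.
  by rewrite raddfB /= mxtrace_scalar -mulr_natr wd subrr.
have adjw : adj (w%:M : 'M_d) = (conjc w)%:M.
  by rewrite /adj map_scalar_mx tr_scalar_mx.
have VV : \tr (V *m adj V) = d%:R * (1 - `|w| ^+ 2).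
  have : \tr (W *m adj W) = d%:R by rewrite uW mxtrace1.
  rewrite WE adjD adjw mulmxDl !mulmxDr !(mul_scalar_mx, mul_mx_scalar).
  rewrite !raddfD /= !mxtraceZ mxtrace_adj trV conjc0 !mulr0 mxtrace_scalar.
  by rewrite -[_ *+ d]mulr_natr sqr_normc addr0 add0r => /(canRL (addrK _)) ->; ring.
pose t := \tr (adj P *m V *m P *m V^T).
have uP' : adj P *m P = 1%:M by apply/unitaryP.
have trPVP : \tr (adj P *m V *m P) = 0.
  by rewrite mxtrace_mulC mulmxA uP mul1mx.
have sE : s * d%:R = t + w ^+ 2 * d%:R.
  rewrite /s divfK // WE [(_ + _)^T]raddfD /= tr_scalar_mx.
  rewrite !(mulmxDl, mulmxDr) !(mul_scalar_mx, mul_mx_scalar).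
  rewrite -!scalemxAl uP' mul1mx !raddfD /= !mxtraceZ mxtrace_tr.
  by rewrite trPVP trV mxtrace1 !mulr0 add0r addr0 mulrA.
clearbody s w; have t_le : `|t| <= d%:R * (1 - `|w| ^+ 2).
  rewrite -(ler_pM2r (ltr0Sn _ 1)) (le_trans (trace_mul_le _ _)) //.
  rewrite !adjM adjK !mulmxA -(mulmxA _ P) uP mulmx1.
  rewrite -!mulmxA mxtrace_mulC -!mulmxA uP mulmx1 VV.
  have -> : V^T *m adj V^T = (adj V *m V)^T.
    by rewrite trmx_mul; congr (_ *m _); apply/matrixP => i j; rewrite !mxE.
  by rewrite mxtrace_tr mxtrace_mulC VV mulr_natr.
have s_ge : 2 * `|w| ^+ 2 - 1 <= `|s|.
  have d_pos : 0 < d%:R :> C by rewrite ltr0n.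
  rewrite -(ler_pM2r d_pos).
  have -> : `|s| * d%:R = `|t + w ^+ 2 * d%:R| by rewrite -sE normrM (gtr0_norm d_pos).
  rewrite [t + _]addrC; apply: le_trans (lerB_normD _ _).
  rewrite normrM normrX (gtr0_norm d_pos); rewrite -lerN2 in t_le.
  apply: le_trans (lerD (lexx _) t_le).
  by rewrite le_eqVlt; apply/orP; left; apply/eqP; ring.
move: s_ge w_ge; rewrite -abs2E [`|s|]normc_def.
have -> : 2 * ((abs2 w)%:C)%C - 1 = ((2 * abs2 w - 1)%:C)%C :> C.
  by rewrite rmorphB rmorphM /= rmorph1 rmorph_nat.
rewrite lecR -/(abs2 s) => s_ge w_ge.
rewrite -(sqr_sqrtr (abs2_ge0 s)); nra.
Qed.

End Overlap.

(** * Bell states and measurement in rotated Bell bases *)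

Section BellMeasurement.
Variables (R : realType) (k : nat).
Local Notation C := (R[i]).
Local Notation d := (2 ^ k.+1)%N.
Local Notation mat := 'M[C]_(2 ^ k.+1).
Local Notation I := 'I_(2 ^ k.+1).
Local Notation pauli := (@pauli R k).

Definition bell_norm : C := ((Num.sqrt (d%:R : R))^-1)%:C%C.

Lemma conjcM (y z : C) : conjc (y * z) = conjc y * conjc z.
Proof. exact: rmorphM. Qed.

Lemma sum_delta (S : finType) (t : S) (f : S -> C) :
  \sum_s (s == t)%:R * f s = f t.
Proof.
rewrite (bigD1 t) //= eqxx mul1r big1 ?addr0 // => s /negPf ->.
by rewrite mul0r.
Qed.

Lemma bell_norm_sq : bell_norm * bell_norm = d%:R^-1.
Proof.
rewrite /bell_norm -rmorphM -invfM -expr2 sqr_sqrtr ?ler0n //.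
by rewrite fmorphV rmorph_nat.
Qed.

Lemma bell_norm_conj : conjc bell_norm = bell_norm.
Proof. exact: conjc_real. Qed.

Lemma dim_neq0 : (d%:R : C) != 0.
Proof. by rewrite pnatr_eq0 expn_eq0. Qed.

(* The amplitude of the outcome [b] when the state with coefficient matrix [M]
   is measured in the Bell basis rotated by [G]. *)
Definition bell_amp (G M : mat) (b : plabel k) : C :=
  \tr (adj (G *m pauli b) *m M) / d%:R.

Lemma rotated_pauli_complete (G : mat) i j i' j' : unitary G ->
  \sum_a (G *m pauli a) i j * conjc ((G *m pauli a) i' j') =
  d%:R * ((i == i')%:R * (j == j')%:R).
Proof.
move=> uG.
transitivity (\sum_l \sum_l' (G i l * conjc (G i' l') *
   \sum_a pauli a l j * conjc (pauli a l' j'))).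
  under [RHS]eq_bigr => l _ do (under eq_bigr do rewrite mulr_sumr;
    rewrite exchange_big /=).
  rewrite exchange_big /=; apply: eq_bigr => a _.
  rewrite !mxE rmorph_sum big_distrlr /=; apply: eq_bigr => l _.
  by apply: eq_bigr => l' _; rewrite rmorphM; ring.
transitivity (d%:R * ((G *m adj G) i i' * (j == j')%:R)).
  rewrite mxE mulr_suml mulr_sumr; apply: eq_bigr => l _.
  rewrite (bigD1 l) //= [X in _ + X]big1 ?addr0 => [|l' nl].
    by rewrite pauli_complete eqxx mul1r adjE; ring.
  by rewrite pauli_complete eq_sym (negPf nl) mul0r !mulr0.
by rewrite uG mxE.
Qed.

(** Parseval for the Pauli expansion of [adj G *m M]. *)
Lemma bell_amp_total (G M : mat) : unitary G -> unitary M ->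
  \sum_b abs2 (bell_amp G M b) = 1.
Proof.
move=> uG /unitaryP uM; apply: (@complexI R); rewrite rmorph_sum rmorph1 /=.
under eq_bigr do rewrite abs2E sqr_normc /bell_amp rmorphM mulrACA /=.
rewrite -mulr_suml.
suff -> : \sum_b \tr (adj (G *m pauli b) *m M) *
    conjc (\tr (adj (G *m pauli b) *m M)) = d%:R * d%:R.
  by rewrite fmorphV rmorph_nat mulrACA divff ?dim_neq0 // mulr1.
pose W := adj G *m M.
have uW : W *m adj W = 1%:M.
  by apply: unitaryM; [apply: unitary_adj|apply/unitaryP].
have trE b : \tr (adj (G *m pauli b) *m M) = \tr (pauli b *m W).
  by rewrite adjM pauli_herm -mulmxA.
clearbody W; transitivity (\tr ((d%:R *: W) *m adj W)); last first.
  by rewrite -scalemxAl uW mxtraceZ mxtrace1.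
rewrite pauli_expand mulmx_suml raddf_sum; apply: eq_bigr => b _ /=.
by rewrite trE -scalemxAl mxtraceZ -mxtrace_adj adjM pauli_herm (mxtrace_mulC (adj W)).
Qed.

Lemma bell_amp_phase (G M M0 : mat) b : eq_up_to_phase M0 (G *m pauli b) ->
  abs2 (bell_amp G M b) = abs2 (\tr (adj M0 *m M) / d%:R).
Proof.
move=> [z [z1 ->]]; rewrite adj_scale -scalemxAl mxtraceZ -mulrA abs2M.
suff -> : abs2 (conjc z) = 1 by rewrite mul1r.
by apply: (@complexI R); rewrite abs2E normcJ z1 expr1n.
Qed.

Lemma isometric_bell_input (T : finType) (P : mat) : unitary P ->
  isometric (fun (y : I * (I * T)) (t : T) =>
    (y.2.2 == t)%:R * (P y.1 y.2.1 * bell_norm)).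
Proof.
move=> /unitaryP uP t t'.
transitivity (\sum_i \sum_j \sum_(s : T) (s == t)%:R * ((s == t')%:R *
    (conjc (P i j) * P i j * d%:R^-1)) : C).
  under [RHS]eq_bigr do rewrite pair_bigA.
  rewrite [RHS]pair_bigA; apply: eq_bigr => y _ /=.
  by rewrite !conjcM conjc_nat bell_norm_conj -bell_norm_sq; ring.
under eq_bigr => i _ do under eq_bigr do rewrite sum_delta.
transitivity ((t == t')%:R * (\tr (adj P *m P) * d%:R^-1)); last first.
  by rewrite uP mxtrace1 divff ?dim_neq0 // mulr1.
rewrite /mxtrace exchange_big /= mulr_suml mulr_sumr; apply: eq_bigr => j _.
rewrite mxE mulr_suml mulr_sumr; apply: eq_bigr => i _.
by rewrite adjE.
Qed.

(** The basis [G t] depends on the register [t], so a later measurement can be adapted to earlier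
    outcomes without measuring them. Completeness of the rotated Paulis gives the isometry. *)
Lemma isometric_bell_output (T : finType) (G : T -> mat) :
  (forall t, unitary (G t)) ->
  isometric (fun (x : T * plabel k) (y : I * (I * T)) =>
    (x.1 == y.2.2)%:R *
    (conjc ((G x.1 *m pauli x.2) y.1 y.2.1) * bell_norm)).
Proof.
move=> uG [i [j t]] [i' [j' t']] /=.
transitivity (\sum_(s : T) \sum_b (s == t)%:R * ((s == t')%:R *
    ((G s *m pauli b) i j * conjc ((G s *m pauli b) i' j') * d%:R^-1)) : C).
  rewrite pair_bigA; apply: eq_bigr => x _ /=.
  by rewrite !conjcM conjc_nat conjcK bell_norm_conj -bell_norm_sq; ring.
under eq_bigr do rewrite -mulr_sumr.
rewrite sum_delta -mulr_sumr -mulr_suml rotated_pauli_complete //.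
rewrite mulrAC divff ?dim_neq0 // mul1r !xpair_eqE.
by rewrite -!natrM !mulnb andbC -andbA.
Qed.

Lemma prepares_bell_input q (T : finType) Phi (P : mat) : unitary P ->
  @prepares R k.+1 q T Phi ->
  @prepares R k.+1 q (I * (I * T))%type
    (fun U y => P y.1 y.2.1 * bell_norm * Phi U y.2.2).
Proof.
move=> uP /(prepares_isometric (isometric_bell_input (T := T) uP)).
apply: prepares_ext => U y.
under eq_bigr do rewrite eq_sym -mulrA.
by rewrite sum_delta.
Qed.

Lemma prepares_bell_output q (T : finType) Phi (M : mat -> mat) (G : T -> mat) :
  (forall t, unitary (G t)) ->
  @prepares R k.+1 q (I * (I * T))%type
    (fun U y => M U y.1 y.2.1 * bell_norm * Phi U y.2.2) ->
  @prepares R k.+1 q (T * plabel k)%type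
    (fun U x => Phi U x.1 * bell_amp (G x.1) (M U) x.2).
Proof.
move=> uG /(prepares_isometric (isometric_bell_output uG)).
apply: prepares_ext => U [t b] /=.
transitivity (\sum_i \sum_j \sum_(s : T) (s == t)%:R * (Phi U s *
  (adj (G t *m pauli b) j i * M U i j * d%:R^-1))).
  under [RHS]eq_bigr do rewrite pair_bigA.
  rewrite [RHS]pair_bigA; apply: eq_bigr => y _ /=.
  by rewrite adjE -bell_norm_sq (eq_sym t); ring.
under eq_bigr => i _ do under eq_bigr do rewrite sum_delta.
rewrite /bell_amp /mxtrace exchange_big /= mulr_suml mulr_sumr.
apply: eq_bigr => j _; rewrite mxE mulr_suml mulr_sumr.
by apply: eq_bigr => i _.
Qed.

(* Querying both halves of a Bell state [P] yields the coefficient matrix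
   [U P U^T]. *)
Lemma prepares_pair q (T : finType) Phi (P : mat) : unitary P ->
  @prepares R k.+1 q T Phi ->
  @prepares R k.+1 q.+2 (T * plabel k)%type
    (fun U x => Phi U x.1 * bell_amp 1%:M (U *m P *m U^T) x.2).
Proof.
move=> uP /(prepares_bell_input uP) /prepares_query.
(* Queries reach only the first factor; swapping the halves exposes the second, and its query yields
   the factor [U^T]. *)
pose swap (y : I * (I * T)) := (y.2.1, (y.1, y.2.2)).
have swapK : cancel swap swap by move=> [i [j t]].
move/(prepares_reindex swapK swapK)/prepares_query => prep.
apply: (prepares_bell_output (M := fun U => U *m P *m U^T)
  (G := fun=> 1%:M)); first by move=> _; apply: unitary1.
move: prep => /(prepares_reindex swapK swapK).
apply: prepares_ext => U [i [j t]] /=.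
rewrite mxE !mulr_suml; apply: eq_bigr => l _.
rewrite mxE mulr_sumr !mulr_suml; apply: eq_bigr => l' _.
by rewrite mxE; ring.
Qed.

(** One query on half of the standard Bell state leaves [U] itself as coefficient matrix. *)
Lemma prepares_choi q (T : finType) Phi (G : T -> mat) :
  (forall t, unitary (G t)) ->
  @prepares R k.+1 q T Phi ->
  @prepares R k.+1 q.+1 (T * plabel k)%type
    (fun U x => Phi U x.1 * bell_amp (G x.1) U x.2).
Proof.
move=> uG /(prepares_bell_input (@unitary1 R _)) /prepares_query prep.
apply: (prepares_bell_output (M := id)) => //.
apply: prepares_ext prep => U [i [j t]] /=.
transitivity (\sum_l (l == j)%:R * (U i l * bell_norm * Phi U t)).
  by apply: eq_bigr => l _; rewrite mxE; ring.
exact: sum_delta.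
Qed.

End BellMeasurement.

(** * Majority vote over independent repetitions *)

Section Majority.
Variables (R : realType) (B : finType) (b0 : B).

Definition majority (bs : seq B) : B :=
  odflt b0 [pick b | (size bs < (count_mem b bs).*2)%N].

(** Two distinct values cannot both fill more than half of the list. *)
Lemma majorityE bs b : (size bs < (count_mem b bs).*2)%N -> majority bs = b.
Proof.
move=> maj_b; rewrite /majority; case: pickP => [b' maj_b'|/(_ b)]; last first.
  by rewrite maj_b.
apply/eqP; apply: contraTT maj_b' => ne_b /=; rewrite -leqNgt.
have : (count_mem b bs + count_mem b' bs <= size bs)%N.
  rewrite -count_predUI (_ : count (predI _ _) bs = 0%N) ?addn0 ?count_size //.
  rewrite -(@count_pred0 _ bs); apply: eq_count => x /=.
  by case: eqP => //= ->; rewrite eq_sym (negPf ne_b).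
by move: maj_b; move: (size bs) (count_mem b bs) (count_mem b' bs) => s u v; lia.
Qed.

(** Used for a distribution, whose independent samples have total mass 1, and for tilted weights,
    where it evaluates the exponential moment. *)
Lemma sum_tuple_prod M (w : B -> R) :
  \sum_(bs : M.-tuple B) \prod_(b <- bs) w b = (\sum_b w b) ^+ M.
Proof.
elim: M => [|M IH].
  rewrite (big_pred1 (nil_tuple B)) ?big_nil // => bs.
  by apply/esym/eqP/tuple0.
rewrite exprS -IH big_distrlr pair_bigA /=.
rewrite (reindex (fun x : B * M.-tuple B => [tuple of x.1 :: x.2])) /=.
  by apply: eq_bigr => x _; rewrite big_cons.
exists (fun bs => (thead bs, [tuple of behead bs])) => [[b bs] _|bs _] /=.
  by congr (_, _); apply: val_inj.
by case/tupleP: bs => b bs; apply: val_inj.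
Qed.

(* Exponential Markov with weight [9/8] on wrong and [8/9] on right outcomes:
   (9/16)(8/9) + (7/16)(9/8) = 127/128. *)
Lemma majority_correct M (p : B -> R) b1 :
  (forall b, 0 <= p b) -> \sum_b p b = 1 -> 9 / 16 <= p b1 ->
  1 - (127 / 128) ^+ M <=
    \sum_(bs : M.-tuple B | majority bs == b1) \prod_(b <- bs) p b.
Proof.
move=> p_ge0 p1 p_b1.
have := sum_tuple_prod M p; rewrite p1 expr1n.
rewrite (bigID (fun bs : M.-tuple B => majority bs == b1)) /= => tot.
rewrite -{1}tot lerBlDr lerD2l.
pose w b := p b * (if b == b1 then 8 / 9 else 9 / 8).
have w_ge0 b : 0 <= w b by rewrite mulr_ge0 //; case: ifP => _; lra.
have w_le : \sum_b w b <= 127 / 128.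
  move: p1; rewrite (bigD1 b1) //= [X in _ -> X <= _](bigD1 b1) //= /w eqxx.
  rewrite [X in _ -> _ + X <= _](eq_bigr (fun b => p b * (9 / 8))) => [|b /negPf -> //].
  by rewrite -mulr_suml => p1; lra.
have W_ge0 : 0 <= \sum_b w b by apply: sumr_ge0.
apply: (@le_trans _ _ ((\sum_b w b) ^+ M)); last by rewrite lerXn2r ?nnegrE //; lra.
rewrite -sum_tuple_prod.
rewrite [leRHS](bigID (fun bs : M.-tuple B => majority bs == b1)) /=.
rewrite -[leLHS]add0r lerD //; first by apply: sumr_ge0 => bs _; apply: prodr_ge0.
apply: ler_sum => bs /negP not_maj.
have le_count : ((count_mem b1 bs).*2 <= size bs)%N.
  by rewrite leqNgt; apply/negP => /majorityE/eqP.
have -> : \prod_(b <- bs) w b = \prod_(b <- bs) p b *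
   ((8 / 9) ^+ count_mem b1 bs * (9 / 8) ^+ (size bs - count_mem b1 bs)).
  elim: (tval bs) => [|b s IH]; first by rewrite !big_nil !expr0 !mulr1.
  rewrite !big_cons IH /w /= eq_sym; case: eqP => [->|_] /=.
    by rewrite add1n subSS exprS; ring.
  by rewrite add0n subSn ?count_size // exprS; ring.
rewrite ler_peMr ?prodr_ge0 //.
(* Pairing each right outcome with a wrong one cancels [8/9] against [9/8]; the unpaired wrong ones
   leave a factor at least 1. *)
rewrite (_ : size bs - _ = count_mem b1 bs + (size bs - (count_mem b1 bs).*2))%N; last by lia.
rewrite exprD mulrA -exprMn (_ : 8 / 9 * (9 / 8) = 1) ?expr1n ?mul1r; last by lra.
by apply: exprn_ege1; lra.
Qed.

End Majority.

(** * Coherent composition of learning steps *)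

Section Learning.
Variables (R : realType) (k : nat).
Local Notation C := (R[i]).
Local Notation d := (2 ^ k.+1)%N.
Local Notation mat := 'M[C]_(2 ^ k.+1).
Local Notation pauli := (@pauli R k).

(** The threshold is [7/8 = 1 - (sqrt 2 / 4)^2]. *)
Definition close (U W : mat) := [/\ unitary U, clifford W &
  7 / 8 <= abs2 (\tr (adj W *m U) / d%:R)].

(** The register stays unmeasured and [f] is its classical reading, so later experiments can be
    controlled on it. The target [tau W] may be partial information about [W]. *)
Definition learns q (X : finType) (tau : mat -> X) (c : R) : Prop :=
  exists (T : finType) (Phi : mat -> T -> C) (f : T -> X),
    @prepares R k.+1 q T Phi /\
    forall U W, close U W -> c <= \sum_(t | f t == tau W) abs2 (Phi U t).

(** A measurement chosen from earlier outcomes, in coherent form: a fresh label is adjoined under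
    control of the old register. *)
Definition experiment q (X : finType) (amp : X -> mat -> plabel k -> C) : Prop :=
  (forall x U, unitary U -> \sum_b abs2 (amp x U b) = 1) /\
  forall q' (T : finType) Phi (f : T -> X), @prepares R k.+1 q' T Phi ->
    @prepares R k.+1 (q + q') (T * plabel k)%type
      (fun U x => Phi U x.1 * amp (f x.1) U x.2).

Lemma prepares_repeat M q c (X T : finType) Phi (f : T -> X) amp :
  experiment c amp -> @prepares R k.+1 q T Phi ->
  @prepares R k.+1 (M * c + q) (T * M.-tuple (plabel k))%type
    (fun U x => Phi U x.1 * \prod_(b <- x.2) amp (f x.1) U b).
Proof.
move=> [_ expt] prep; elim: M => [|M IH].
  pose h t : T * 0.-tuple (plabel k) := (t, [tuple]).
  have hK : cancel fst h by move=> [t bs]; rewrite /h tuple0.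
  have := prepares_reindex hK (fun _ => erefl) prep.
  by apply: prepares_ext => U [t bs]; rewrite tuple0 /= big_nil mulr1.
pose B := plabel k.
pose g (x : T * M.+1.-tuple B) := ((x.1, [tuple of behead x.2]), thead x.2).
pose h (y : (T * M.-tuple B) * B) := (y.1.1, [tuple of y.2 :: y.1.2]).
have gK : cancel g h.
  by move=> [t bs]; rewrite /g /h /=; congr (_, _); rewrite -tuple_eta.
have hK : cancel h g.
  by move=> [[t bs] b]; rewrite /g /h /=; congr (_, _, _); apply: val_inj.
have := expt _ _ _ (fun x => f x.1) IH.
rewrite addnA -mulSn => /(prepares_reindex gK hK).
apply: prepares_ext => U [t bs] /=; case/tupleP: bs => b bs /=.
by rewrite big_cons theadE -mulrA [X in _ * X]mulrC.
Qed.

Lemma learns_step M q c (X : finType) tau p amp (beta : mat -> plabel k) :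
  experiment c amp -> 0 <= p ->
  (forall U W, close U W -> 9 / 16 <= abs2 (amp (tau W) U (beta W))) ->
  @learns q X tau p ->
  learns (M * c + q) (fun W => (tau W, beta W)) (p * (1 - (127 / 128) ^+ M)).
Proof.
move=> expt p_ge0 good [T [Phi [f [prep succ]]]].
exists (T * M.-tuple (plabel k))%type,
  (fun U (x : T * M.-tuple (plabel k)) =>
    Phi U x.1 * \prod_(b <- x.2) amp (f x.1) U b),
  (fun x : T * M.-tuple (plabel k) => (f x.1, majority (pzero k) x.2)); split.
  exact: (prepares_repeat M f expt prep).
move=> U W cUW.
apply: (@le_trans _ _ (\sum_(t | f t == tau W)
   \sum_(bs : M.-tuple (plabel k) | majority (pzero k) bs == beta W)
     abs2 (Phi U t * \prod_(b <- bs) amp (f t) U b))).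
  apply: (@le_trans _ _ (\sum_(t | f t == tau W)
      abs2 (Phi U t) * (1 - (127 / 128) ^+ M))).
    rewrite -mulr_suml ler_wpM2r ?succ // subr_ge0.
    by apply: exprn_ile1; lra.
  apply: ler_sum => t /eqP ftW.
  under [leRHS]eq_bigr do rewrite abs2M.
  rewrite -mulr_sumr ler_wpM2l ?abs2_ge0 //.
  have abs2_prod (s : seq (plabel k)) (F : plabel k -> C) :
      abs2 (\prod_(b <- s) F b) = \prod_(b <- s) abs2 (F b).
    apply: (big_morph _ (@abs2M R)).
    by apply: (@complexI R); rewrite abs2E normr1 expr1n.
  under [leRHS]eq_bigr do rewrite abs2_prod.
  have [uU _ _] := cUW.
  apply: majority_correct => [b||]; first exact: abs2_ge0.
    by case: expt => ->.
  by rewrite ftW; apply: good.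
rewrite pair_big_dep /= le_eqVlt; apply/orP; left; apply/eqP.
by apply: eq_bigl => x; rewrite xpair_eqE.
Qed.

End Learning.

(** * The Clifford learner and the guessing learner *)

Section CliffordLearning.
Variables (R : realType) (k : nat).
Local Notation C := (R[i]).
Local Notation d := (2 ^ k.+1)%N.
Local Notation mat := 'M[C]_(2 ^ k.+1).
Local Notation pauli := (@pauli R k).
Local Notation eta := (127 / 128 : R).

Lemma majority_prob_ge0 M : 0 <= 1 - eta ^+ M.
Proof. by rewrite subr_ge0; apply: exprn_ile1; lra. Qed.

Definition label (P : mat) : plabel k :=
  odflt (pzero k) [pick b | `[< eq_up_to_phase P (pauli b) >]].

Lemma labelE P : is_pauli P -> eq_up_to_phase P (pauli (label P)).
Proof.
move=> [b Pb]; rewrite /label; case: pickP => [c /asboolP //|/(_ b)].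
by move/asboolP.
Qed.

Lemma experiment_pair (X : finType) (P : mat) : unitary P ->
  experiment 2 (fun (_ : X) U => bell_amp 1%:M (U *m P *m U^T)).
Proof.
move=> uP; split=> [_ U uU|q T Phi f]; last exact: prepares_pair.
apply: bell_amp_total; first exact: unitary1.
by apply: unitaryM; [apply: unitaryM|apply: unitary_tr].
Qed.

Lemma experiment_choi (X : finType) (G : X -> mat) :
  (forall x, unitary (G x)) -> experiment 1 (fun x U => bell_amp (G x) U).
Proof.
move=> uG; split=> [x U uU|q T Phi f]; first exact: bell_amp_total.
by apply: (@prepares_choi _ _ _ _ _ (fun t => G (f t))) => t.
Qed.

(** By cyclicity of the trace, the overlap of [U P U^T] with [W P W^T] is the quantity bounded in
    [conj_trace_ge], for [adj W *m U]. *)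
Lemma pair_amp_ge (U W : mat) b : close U W ->
  9 / 16 <= abs2 (bell_amp 1%:M (U *m pauli b *m U^T)
                    (label (W *m pauli b *m W^T))).
Proof.
move=> [uU cW UW]; have [uW _] := cW.
rewrite (@bell_amp_phase _ _ _ _ (W *m pauli b *m W^T)); last first.
  by rewrite mul1mx; apply/labelE/clifford_congruence_pauli.
have uWU : unitary (adj W *m U) by apply: unitaryM => //; apply: unitary_adj.
have dim_gt0 : (0 < d)%N by rewrite expn_gt0.
have := conj_trace_ge dim_gt0 (unitary_pauli R b) uWU UW.
have -> : (adj W *m U)^T = U^T *m adj W^T.
  by rewrite trmx_mul; congr (_ *m _); apply/matrixP => i j; rewrite !mxE.
by rewrite -!mulmxA => ge; rewrite !adjM -!mulmxA mxtrace_mulC -!mulmxA.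
Qed.

Lemma learns_labels M (gs : seq (plabel k)) :
  exists (X : finType) (tau : mat -> X),
    learns (size gs * (M * 2)) tau ((1 - eta ^+ M) ^+ size gs) /\
    forall W W', tau W = tau W' -> {in gs, forall g,
      label (W *m pauli g *m W^T) = label (W' *m pauli g *m W'^T)}.
Proof.
elim: gs => [|g gs [X [tau [learn tauE]]]] /=.
  exists unit, (fun=> tt); split=> //.
  exists unit, (fun _ _ => 1), id; split.
    apply: (@prepares_const _ _ _ (fun=> 1)).
    by rewrite (big_pred1 tt) => [|[]//]; rewrite conjc1 mulr1.
  move=> U W _; rewrite (big_pred1 tt) => [|[]//].
  by rewrite /abs2 /= expr1n expr0n addr0.
exists (X * plabel k)%type,
  (fun W => (tau W, label (W *m pauli g *m W^T))); split.
  rewrite mulSn exprSr.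
  apply: (learns_step M (experiment_pair X (unitary_pauli R g)) _ _ learn).
    by apply/exprn_ge0/majority_prob_ge0.
  by move=> U W; apply: pair_amp_ge.
move=> W W' [tauW labW] h; rewrite inE => /orP[/eqP -> //|].
exact: tauE.
Qed.

Definition learned_gens := pzero k :: pgens k.

(** [G x] is any Clifford whose data is [x]; a Clifford with the same labels differs from it by a
    Pauli on the right. *)
Lemma decoder (X : finType) (tau : mat -> X) :
  (forall W W', tau W = tau W' -> {in learned_gens, forall g,
      label (W *m pauli g *m W^T) = label (W' *m pauli g *m W'^T)}) ->
  exists2 G : X -> mat, (forall x, unitary (G x)) &
    forall W, clifford W -> is_pauli (adj (G (tau W)) *m W).
Proof.
move=> tauE.
pose good x (V : mat) := unitary V /\
  forall W, clifford W -> tau W = x -> clifford V /\ tau V = x.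
have [G GP] : exists G : X -> mat, forall x, good x (G x).
  apply: (@fin_all_exists X (fun=> mat) good) => x.
  have [[W [cW Wx]]|no] := pselect (exists W, clifford W /\ tau W = x).
    by exists W; split=> //; case: cW.
  (* Data realised by no Clifford still needs a unitary basis, so the identity is used. *)
  exists 1%:M; split; first exact: unitary1.
  by move=> W cW Wx; case: no; exists W.
exists G => [x|W cW]; first by case: (GP x).
have [uG /(_ W cW erefl) [cG Gx]] := GP (tau W).
apply: same_labels_pauli => //; first by case: cW.
move=> g g_in.
apply: eq_up_to_phase_trans (labelE (clifford_congruence_pauli g cW)) _.
rewrite -(tauE _ _ Gx) //; apply: eq_up_to_phase_sym; apply: labelE.
exact: clifford_congruence_pauli.
Qed.

Lemma decoded_up_to_phase (G W : mat) : unitary G -> is_pauli (adj G *m W) ->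
  eq_up_to_phase W (G *m pauli (label (adj G *m W))).
Proof.
move=> uG /labelE[z [z1 E]]; exists z; split=> //.
by rewrite scalemxAr -E mulmxA uG mul1mx.
Qed.

Lemma choi_amp_ge (G U W : mat) : unitary G -> close U W ->
  is_pauli (adj G *m W) ->
  9 / 16 <= abs2 (bell_amp G U (label (adj G *m W))).
Proof.
move=> uG [_ _ UW] GW.
rewrite (bell_amp_phase _ (decoded_up_to_phase uG GW)).
by apply: le_trans UW; lra.
Qed.

(** With [n = k.+1]: [2n + 1] labels at [2M] queries each, then [M] Choi queries, hence [2n + 2]
    majority votes. *)
Lemma clifford_learner M : exists2 A : query_alg R k.+1,
  nq A = (M + k.+1.*2.+1 * (M * 2))%N &
  forall U W, close U W ->
    (1 - eta ^+ M) ^+ k.+1.*2.+2 <= success_prob A U W.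
Proof.
have [X [tau [learn /decoder[G uG GP]]]] := learns_labels M learned_gens.
have := learns_step M (experiment_choi uG) _
  (beta := fun W => label (adj (G (tau W)) *m W)) _ learn.
rewrite /= size_pgens muln1 -exprSr => {}learn.
have [|U W cUW|T [Phi [f [prep succ]]]] := learn.
- by apply/exprn_ge0/majority_prob_ge0.
- by apply: choi_amp_ge => //; apply: GP; case: cUW.
have [A nqA probA] :=
  prepares_query_alg (fun t => G (f t).1 *m pauli (f t).2) prep.
exists A => // U W cUW; apply: le_trans (succ _ _ cUW) _.
apply: le_trans (probA U W); rewrite [leRHS](bigID (fun t =>
  f t == (tau W, label (adj (G (tau W)) *m W)))) /=.
rewrite -[leLHS]addr0 lerD //; last by apply: sumr_ge0 => t _; apply: abs2_ge0.
rewrite le_eqVlt; apply/orP; left; apply/eqP; apply: eq_bigl => t.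
case: eqP => [->|]; rewrite ?andbF //= andbT; apply/esym/asboolP.
apply: eq_up_to_phase_sym; apply: decoded_up_to_phase => //.
by apply: GP; case: cUW.
Qed.

(** A uniform superposition over the finitely many decoder outputs gives every Clifford the same
    positive chance. *)
Lemma clifford_guess : exists2 c : R, 0 < c < 1 &
  exists2 A : query_alg R k.+1, nq A = 0 &
    forall U W, clifford W -> c <= success_prob A U W.
Proof.
have [X [tau [_ /decoder[G uG GP]]]] := learns_labels 0 learned_gens.
(* The [bool] factor forces [#|T| > 1], so that [c < 1] strictly. *)
pose T : finType := (X * plabel k * bool)%type.
have T_gt1 : (1 < #|T|)%N.
  have X_gt0 : (0 < #|{: (X * plabel k)%type}|)%N.
    by apply/card_gt0P; exists (tau 1%:M, pzero k).
  by rewrite card_prod card_bool; apply: leq_mul X_gt0 (leqnn 2).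
have T_pos : 0 < #|T|%:R :> R by rewrite ltr0n ltnW.
pose r : R := (Num.sqrt #|T|%:R)^-1.
have r_sq : r ^+ 2 = #|T|%:R^-1 by rewrite exprVn sqr_sqrtr // ltW.
exists (r ^+ 2).
  by rewrite r_sq invr_gt0 T_pos invf_lt1 // ltr1n.
have [|A nqA probA] := @prepares_query_alg R k.+1 0 T (fun _ _ => r%:C%C)
    (fun t => G t.1.1 *m pauli t.1.2).
  apply: (@prepares_const R k.+1 T (fun=> r%:C%C)).
  under eq_bigr do rewrite conjc_real -rmorphM -expr2 r_sq.
  by rewrite sumr_const -[_ *+ _]mulr_natr fmorphV rmorph_nat mulVf // pnatr_eq0
    -lt0n ltnW.
exists A => // U W cW; apply: le_trans (probA U W).
rewrite (bigD1 (tau W, label (adj (G (tau W)) *m W), true)) /=; last first.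
  apply/asboolP/eq_up_to_phase_sym/decoded_up_to_phase => //.
  exact: GP.
rewrite {1}/abs2 /= [0 ^+ 2]expr0n addr0 lerDl.
by apply: sumr_ge0 => t _; apply: abs2_ge0.
Qed.

End CliffordLearning.

(** * From distance to overlap, and the number of queries *)

Section QueryCount.
Variable R : realType.

Lemma close_of_dist k (eps : R) (U W : 'M[R[i]]_(2 ^ k.+1)) :
  eps < Num.sqrt 2 / 4 -> unitary U -> clifford W -> dist U W <= eps ->
  close U W.
Proof.
move=> eps_lt uU cW dUW; split=> //; rewrite mxtrace_mulC abs2M.
have -> : abs2 ((2 ^ k.+1)%:R^-1 : R[i]) = ((2 ^ k.+1)%:R ^+ 2)^-1.
  apply: (@complexI R).
  by rewrite abs2E normfV normr_nat exprVn fmorphV rmorphXn rmorph_nat.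
move: dUW; rewrite /dist; set x := 1 - _ => dUW.
suff : x <= 1 / 8 by rewrite /x; lra.
(* Arguing by contradiction makes the radicand positive, so the square root can be squared back. *)
rewrite leNgt; apply/negP => x_gt.
have s2 : Num.sqrt 2 ^+ 2 = 2 :> R by rewrite sqr_sqrtr.
have s2_ge0 : 0 <= Num.sqrt 2 :> R := sqrtr_ge0 _.
have sx_ge0 : 0 <= Num.sqrt x := sqrtr_ge0 _.
have sx : Num.sqrt x ^+ 2 = x by rewrite sqr_sqrtr //; lra.
have : Num.sqrt x < Num.sqrt 2 / 4 by apply: le_lt_trans eps_lt.
nra.
Qed.

Lemma bernoulli (x : R) m : 0 <= x <= 1 -> 1 - m%:R * x <= (1 - x) ^+ m.
Proof.
move=> /andP[x_ge0 x_le1]; elim: m => [|m IH].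
  by rewrite mul0r subr0 expr0.
rewrite exprS; apply: (@le_trans _ _ ((1 - x) * (1 - m%:R * x))).
  rewrite -natr1; have : 0 <= m%:R :> R by [].
  nra.
by rewrite ler_wpM2l // subr_ge0.
Qed.

(** This is [1 - 1/128 <= exp (-1/128)] raised to the power [M]. *)
Lemma majority_error_le M (a : R) : 0 < a -> 128 * ln a <= M%:R ->
  (127 / 128) ^+ M <= a^-1.
Proof.
move=> a_gt0 le_M.
apply: (@le_trans _ _ (expR (- (1 / 128)) ^+ M)).
  apply: lerXn2r; rewrite ?nnegrE ?expR_ge0 //; first by lra.
  by have := expR_ge1Dx (- (1 / 128) : R); lra.
rewrite -expRM_natl -[leRHS]lnK ?posrE ?invr_gt0 // lnV ?posrE //.
by rewrite ler_expR; lra.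
Qed.

Lemma learner_with_confidence k (delta : R) : 0 < delta -> delta < 1 ->
  exists2 A : query_alg R k.+1,
    (nq A)%:R <= 7 * k.+1%:R * (128 * ln 4 + 128 * ln (k.+1%:R / delta) + 1) &
    forall U W, close U W -> 1 - delta <= success_prob A U W.
Proof.
move=> d_gt0 d_lt1; set n : R := k.+1%:R.
have n_ge1 : 1 <= n by rewrite ler1n.
(* Each of the [2n + 2] votes may fail with probability [1 / a = delta / (2n + 2)]; Bernoulli's
   inequality adds these up. *)
pose a := (k.+1.*2.+2)%:R / delta.
have aE : a = (2 * n + 2) / delta.
  by rewrite /a -addn2 natrD -muln2 natrM mulrC -/n mulrC [n * _]mulrC.
have a_gt0 : 0 < a by rewrite aE divr_gt0 //; lra.
have a_ge1 : 1 <= a by rewrite aE ler_pdivlMr //; lra.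
pose y := 128 * ln a.
have y_ge0 : 0 <= y by rewrite mulr_ge0 ?ln_ge0.
have [A nqA probA] := clifford_learner R k (Num.truncn y).+1.
have le_y : y <= (Num.truncn y).+1%:R by rewrite ltW ?truncnS_gt.
have le_t : (Num.truncn y)%:R <= y by rewrite truncn_le.
exists A.
  (* The 4 comes from [2n + 2 <= 4n]; below, the 7 comes from [4n + 3 <= 7n]. *)
  have le_ln : ln a <= ln 4 + ln (n / delta).
    have nd_gt0 : 0 < n / delta by rewrite divr_gt0 //; lra.
    have nd4_gt0 : 0 < 4 * (n / delta) by rewrite mulr_gt0.
    rewrite -lnM ?posrE // ler_ln ?posrE // aE mulrA.
    by rewrite ler_wpM2r ?invr_ge0 ?(ltW d_gt0) //; lra.
  rewrite nqA; set t := Num.truncn y in le_t le_y *.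
  have -> : (t.+1 + k.+1.*2.+1 * (t.+1 * 2))%N%:R = (t%:R + 1) * (4 * n + 3) :> R.
    rewrite natrD !natrM -[t.+1%:R]natr1 -[_.*2.+1%:R]natr1 -muln2 natrM -/n.
    by ring.
  have t_ge0 : 0 <= t%:R :> R by [].
  have t_le : t%:R + 1 <= 128 * ln 4 + 128 * ln (n / delta) + 1.
    by move: le_t; rewrite /y; lra.
  nra.
move=> U W cUW; apply: le_trans (probA _ _ cUW).
have e_le := majority_error_le a_gt0 le_y.
have e_ge0 : 0 <= (127 / 128 : R) ^+ (Num.truncn y).+1 by apply: exprn_ge0; lra.
have e_le1 : (127 / 128 : R) ^+ (Num.truncn y).+1 <= 1 by apply: exprn_ile1; lra.
apply: le_trans (bernoulli _ _); last by rewrite e_ge0 e_le1.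
rewrite lerD2l lerN2.
apply: (@le_trans _ _ ((k.+1.*2.+2)%:R * a^-1)); first by rewrite ler_wpM2l.
by rewrite /a invf_div mulrCA divff ?mulr1 // pnatr_eq0.
Qed.

End QueryCount.

(** * The query bound with an absolute constant *)

Theorem theorem2 (R : realType) :
  exists K : R, 0 < K /\
  forall (n : nat) (eps delta : R),
    (1 <= n)%N -> 0 <= eps -> eps < Num.sqrt 2 / 4 -> 0 < delta -> delta < 1 ->
    exists A : query_alg R n,
      (nq A)%:R <= K * (n%:R * ln (n%:R / delta)) / (Num.sqrt 2 / 4 - eps) ^+ 2 /\
      forall U C0 : 'M[R[i]]_(2 ^ n),
        unitary U -> clifford C0 -> dist U C0 <= eps ->
        1 - delta <= success_prob A U C0.
Proof.
have [c /andP[c_gt0 c_lt1] [A0 nqA0 probA0]] := clifford_guess R 0.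
(* A positive lower bound for [ln (n / delta)] outside the guessing case; dividing by it lets [B]
   absorb the additive constant of the query count. *)
pose L := Num.min (ln 2) (ln (1 - c)^-1).
have L_gt0 : 0 < L.
  rewrite lt_min !ln_gt0 ?ltr1n //= invf_gt1 //; lra.
have ln4_ge0 : 0 <= ln 4 :> R by rewrite ln_ge0 // ler1n.
pose B := (128 * ln 4 + 1) / L.
have B_gt0 : 0 < B by rewrite divr_gt0 //; lra.
exists (7 * (B + 128)); split; first by lra.
move=> [//|k] eps delta _ eps_ge0 eps_lt d_gt0 d_lt1.
have gap_gt0 : 0 < Num.sqrt 2 / 4 - eps by rewrite subr_gt0.
(* Dividing by a square at most 1 only relaxes the bound. *)
have gap_le1 : (Num.sqrt 2 / 4 - eps) ^+ 2 <= 1.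
  have s2 : Num.sqrt 2 ^+ 2 = 2 :> R by rewrite sqr_sqrtr.
  have s2_ge0 : 0 <= Num.sqrt 2 :> R := sqrtr_ge0 _.
  nra.
have n_ge1 : 1 <= k.+1%:R :> R by rewrite ler1n.
have nd_ge1 : 1 <= k.+1%:R / delta by rewrite ler_pdivlMr //; lra.
have ln_ge0 : 0 <= ln (k.+1%:R / delta) by rewrite ln_ge0.
have weaken (q : R) : q <= 7 * (B + 128) * (k.+1%:R * ln (k.+1%:R / delta)) ->
    q <= 7 * (B + 128) * (k.+1%:R * ln (k.+1%:R / delta)) /
           (Num.sqrt 2 / 4 - eps) ^+ 2.
  move=> le_q; apply: (le_trans le_q); rewrite ler_peMr //.
    by rewrite !mulr_ge0 //; lra.
  by rewrite invf_ge1 // exprn_gt0.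
have [guess|] := boolP ((k == 0%N) && (1 - delta <= c)).
  case/andP: guess => /eqP k0 le_c; subst k.
  exists A0; split; first by apply: weaken; rewrite nqA0 !mulr_ge0 //; lra.
  by move=> U W _ cW _; apply: le_trans le_c (probA0 U W cW).
move=> no_guess.
(* For one qubit [delta < 1 - c], giving the second term of the minimum; for more, [n / delta >= 2]
   gives the first. *)
have L_le : L <= ln (k.+1%:R / delta).
  rewrite ge_min; case: k n_ge1 nd_ge1 no_guess {ln_ge0 weaken} => [|k] n1 nd1 /=.
    rewrite -ltNge => lt_c; apply/orP; right.
    rewrite ler_ln ?posrE ?invr_gt0 ?subr_gt0 //; last by lra.
    by rewrite mul1r lef_pV2 ?posrE //; lra.
  move=> _; apply/orP; left; rewrite ler_ln ?posrE //; last by lra.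
  rewrite ler_pdivlMr //; have : 2 <= k.+2%:R :> R by rewrite ler_nat.
  lra.
have [A nqA probA] := learner_with_confidence k d_gt0 d_lt1.
exists A; split; last first.
  move=> U W uU cW dUW; apply: probA; exact: close_of_dist dUW.
apply: weaken; apply: (le_trans nqA).
rewrite -mulrA -mulrA ler_pM2l // mulrCA ler_wpM2l ?ler0n //.
have : 128 * ln 4 + 1 <= B * ln (k.+1%:R / delta).
  by rewrite /B -mulrA ler_peMr //; [lra|rewrite mulrC ler_pdivlMr // mul1r].
lra.
Qed.
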